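(* Let $n>2$, let $p_1,\dots,p_{n-1},q$ be integers with $1+|p_{n-1}|+\dots+|p_1|<|q|$, and let $t(x)=x^n+p_{n-1}x^{n-1}+\dots+p_1x-q$. Then $\mathrm{Dom}_{\overline p,q}$ is regular and $\psi_{\overline p,q}:\mathrm{Dom}_{\overline p,q}\to\mathbb{Z}^n$ is an FA-presentation of $(\mathbb{Z}^n,+)$ (the addition relation on $\mathrm{Dom}_{\overline p,q}$ transported via $\psi_{\overline p,q}$ is FA-recognizable). If moreover $\gcd(p_1,q)=1$, then for none of the cyclic components $\langle\xi\rangle,\langle\eta_1\rangle,\dots,\langle\eta_{n-1}\rangle$ of $\mathbb{Z}^n=\langle\xi\rangle\oplus\langle\eta_1\rangle\oplus\dots\oplus\langle\eta_{n-1}\rangle$ is the preimage under $\psi_{\overline p,q}$ regular, and none of the projections of $\mathbb{Z}^n$ onto these components is FA-recognizable with respect to $\psi_{\overline p,q}$ (i.e. for each such projection $\pi$, the relation $\{(u,v):\psi_{\overline p,q}(v)=\pi(\psi_{\overline p,q}(u))\}$ is not FA-recognizable).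
   Context: For $f,g\in\mathbb{Z}[x]$ write $f\sim g$ if $t$ divides $f-g$; identify $\mathbb{Z}^n$ with the additive group of $\mathbb{Z}[x]/\langle t\rangle$ (basis the classes of $1,x,\dots,x^{n-1}$), and put $\xi=[1]_\sim$, $\eta_i=[x^i]_\sim$ for $i=1,\dots,n-1$; write $\overline p=\langle p_1,\dots,p_{n-1}\rangle$. Let $\Sigma_q=\{-(|q|-1),\dots,|q|-1\}$ ordered naturally; a string $a_0a_1\dots a_m\in\Sigma_q^*$ represents the polynomial $a_mx^m+\dots+a_0$, and two strings are equivalent if their polynomials are $\sim$-equivalent. $\mathrm{Dom}_{\overline p,q}$ is the set of $w\in\Sigma_q^*$ such that no string strictly smaller than $w$ in the length-lexicographic order is equivalent to $w$, and $\psi_{\overline p,q}(w)$ is the $\sim$-class of the polynomial represented by $w$. Convolution of strings pads shorter strings with a new symbol $\diamond$ and stacks them letterwise; a relation on strings is FA-recognizable if the set of convolutions of its tuples is accepted by a finite automaton; a function is FA-recognizable if its graph is. *)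

(* Defs.v *)
From HB Require Import structures.
From mathcomp Require Import all_boot all_order all_algebra.
Set Implicit Arguments. Unset Strict Implicit. Unset Printing Implicit Defensive.
Import Order.TTheory GRing.Theory Num.Theory.
Local Open Scope ring_scope.

Record dfa (A : Type) := DFA {
  dstate : finType;
  dinit : dstate;
  dtrans : dstate -> A -> dstate;
  dfinal : pred dstate }.

Definition accepts (A : Type) (M : dfa A) (w : seq A) : bool :=
  @dfinal A M (foldl (@dtrans A M) (@dinit A M) w).

Definition regular (A : Type) (L : seq A -> Prop) : Prop :=
  exists M : dfa A, forall w, accepts M w <-> L w.

(* Convolution of strings: pad with diamond (= None) and stack letterwise. *)
Definition conv2 (A : Type) (u v : seq A) : seq (option A * option A) :=
  mkseq (fun i => (onth u i, onth v i)) (maxn (size u) (size v)).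

Definition conv3 (A : Type) (u v w : seq A)
    : seq (option A * option A * option A) :=
  mkseq (fun i => (onth u i, onth v i, onth w i))
        (maxn (size u) (maxn (size v) (size w))).

Definition FA_rec2 (A : Type) (R : seq A -> seq A -> Prop) : Prop :=
  regular (fun x => exists u v, R u v /\ x = conv2 u v).

Definition FA_rec3 (A : Type) (R : seq A -> seq A -> seq A -> Prop) : Prop :=
  regular (fun x => exists u v w, R u v w /\ x = conv3 u v w).

Definition tpoly (n : nat) (p : nat -> int) (q : int) : {poly int} :=
  'X^n + \sum_(1 <= i < n) (p i)%:P * 'X^i - q%:P.

Definition simt (t f g : {poly int}) : Prop :=
  exists h : {poly int}, f - g = h * t.

Definition in_Sigma (q : int) (w : seq int) : bool :=
  all (fun a => `|a| < `|q|) w.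

(* the string a_0 a_1 ... a_m represents a_m x^m + ... + a_0 *)
Definition spoly (w : seq int) : {poly int} := Poly w.

Fixpoint lexlt (u w : seq int) : bool :=
  match u, w with
  | a :: u', b :: w' => (a < b) || ((a == b) && lexlt u' w')
  | [::], _ :: _ => true
  | _, _ => false
  end.

Definition llt (u w : seq int) : bool :=
  (size u < size w)%N || ((size u == size w) && lexlt u w).

Definition Dom (n : nat) (p : nat -> int) (q : int) (w : seq int) : Prop :=
  in_Sigma q w /\
  forall u, in_Sigma q u -> llt u w -> ~ simt (tpoly n p q) (spoly u) (spoly w).

(* Main.v *)
Require Import Defs.
From HB Require Import structures.
From mathcomp Require Import all_boot all_order all_algebra.
From mathcomp Require Import zify ring.
Set Implicit Arguments. Unset Strict Implicit. Unset Printing Implicit Defensive.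
Import Order.TTheory GRing.Theory Num.Theory.
Local Open Scope ring_scope.

(* Division by [t] with the least significant digit first is a finite transducer:
   the carry [g] after reading digit [a] becomes [(g + a - c t) / x], where [c]
   cancels the constant term, and since the non-constant coefficients of [t] have
   total absolute value less than [|q|], bounded digits keep the carry bounded.
   Hence equivalence of digit strings, and with it [Dom] (by projection and
   complement) and addition, are regular.  Truncated division by [q] in the same
   recursion decreases the sum of the absolute values of the coefficients, so
   every class is represented by a digit string.

   If the preimage of [<[x^k]>] were regular, pumping a word of it would give, in
   [Z[x]/t], a relation [m0 x^b = m1] with [m0 <> 0] and [b > 0].  As [p_1] is
   prime to [q] this is impossible: the cofactor of [t] in [m0 x^b - m1] would be
   divisible by every power of [q].  A recognizable projection would make this
   preimage regular, since the preimage is the set of its fixed points. *)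

(** * Regular languages: closure properties and pumping *)

Lemma eq_regular (A : Type) (L L' : seq A -> Prop) :
  (forall w, L w <-> L' w) -> regular L -> regular L'.
Proof.
move=> LL' [M hM]; exists M => w.
by split=> [/(hM w)/(LL' w)|/(LL' w)/(hM w)].
Qed.

(** Acceptance is boolean; this stands in for excluded middle in later case analyses. *)
Lemma regular_dec (A : Type) (L : seq A -> Prop) :
  regular L -> forall w, L w \/ ~ L w.
Proof.
case=> M hM w; case: (boolP (accepts M w)) => [/(hM w)|aw]; first by left.
by right=> /(hM w) Lw; rewrite Lw in aw.
Qed.

(* The state space [S] may be infinite, as long as the reachable states satisfy
   an invariant under which they are recovered from a finite encoding. *)
Lemma regular_enc (A S : Type) (F : finType) (s0 : S) (tr : S -> A -> S)
    (fin : pred S) (inv : S -> Prop) (enc : S -> F) (dec : F -> S) :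
  inv s0 -> (forall s a, inv s -> inv (tr s a)) ->
  (forall s, inv s -> dec (enc s) = s) ->
  regular (fun w => fin (foldl tr s0 w)).
Proof.
move=> inv0 invS encK.
exists (@DFA A F (enc s0) (fun f a => enc (tr (dec f) a))
          (fun f => fin (dec f))) => w; rewrite /accepts /=.
elim: w s0 inv0 => [|a w IHw] s invs /=; first by rewrite encK.
by rewrite encK //; apply/IHw/invS.
Qed.

Lemma regular_fin (A : Type) (F : finType) (s0 : F) (tr : F -> A -> F)
  (fin : pred F) : regular (fun w => fin (foldl tr s0 w)).
Proof. by exists (@DFA A F s0 tr fin). Qed.

Lemma regular_and (A : Type) (L1 L2 : seq A -> Prop) :
  regular L1 -> regular L2 -> regular (fun w => L1 w /\ L2 w).
Proof.
move=> [M1 h1] [M2 h2].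
pose M := @DFA A (dstate M1 * dstate M2)%type (dinit M1, dinit M2)
  (fun s a => (dtrans s.1 a, dtrans s.2 a))
  (fun s => dfinal s.1 && dfinal s.2).
exists M => w.
have foldlM s1 s2 : foldl (@dtrans A M) (s1, s2) w =
    (foldl (@dtrans A M1) s1 w, foldl (@dtrans A M2) s2 w).
  by elim: w s1 s2 => //= a w IHw s1 s2; rewrite IHw.
rewrite /accepts [dinit M]/= foldlM /=; split.
  by move=> /andP[/(h1 w) ? /(h2 w) ?].
by move=> [/(h1 w) a1 /(h2 w) a2]; apply/andP.
Qed.

Lemma regular_not (A : Type) (L : seq A -> Prop) :
  regular L -> regular (fun w => ~ L w).
Proof.
move=> [M hM].
exists (@DFA A (dstate M) (dinit M) (@dtrans A M) (predC (@dfinal A M))) => w.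
split=> [nM /(hM w)|nL]; first by apply/negP.
by apply/negP => /(hM w).
Qed.

Lemma regular_or (A : Type) (L1 L2 : seq A -> Prop) :
  regular L1 -> regular L2 -> regular (fun w => L1 w \/ L2 w).
Proof.
move=> r1 r2.
apply: eq_regular (regular_not (regular_and (regular_not r1) (regular_not r2))).
move=> w; case: (regular_dec r1 w) => h1; case: (regular_dec r2 w) => h2; tauto.
Qed.

Lemma regular_premap (A B : Type) (f : A -> B) (L : seq B -> Prop) :
  regular L -> regular (fun w => L (map f w)).
Proof.
move=> [M hM].
exists (@DFA A (dstate M) (dinit M) (fun s a => dtrans s (f a)) (@dfinal B M)).
move=> w; rewrite -hM /accepts /=.
suff -> s : foldl (@dtrans B M) s (map f w) =
            foldl (fun s a => dtrans s (f a)) s w by [].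
by elim: w s => //= a w IHw s.
Qed.

Lemma regular_all (A : Type) (P : pred A) : regular (fun w => all P w).
Proof.
apply: eq_regular (regular_fin true (fun b a => b && P a) id) => w.
suff -> b : foldl (fun b a => b && P a) b w = b && all P w by [].
by elim: w b => [|a w IHw] b /=; rewrite ?andbT // IHw andbA.
Qed.

Lemma regular_last (A : Type) (P : pred A) (x0 : A) :
  regular (fun w => P (last x0 w)).
Proof.
apply: eq_regular (regular_fin (P x0) (fun _ a => P a) id) => w.
suff -> x : foldl (fun _ a => P a) (P x) w = P (last x w) by [].
by elim: w x => //= a w IHw x.
Qed.

(* Subset construction. *)
Lemma regular_proj (A : Type) (B : eqType) (bs : seq B)
    (L : seq (A * B) -> Prop) :
  regular L ->
  regular (fun w => exists z, [/\ unzip1 z = w, all (mem bs) (unzip2 z) & L z]).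
Proof.
move=> [M hM].
pose tr (S : {set dstate M}) (a : A) : {set dstate M} :=
  [set s' | [exists s in S, has (fun b => dtrans s (a, b) == s') bs]].
apply: eq_regular
  (regular_fin [set dinit M] tr (fun S => [exists s in S, dfinal s])) => w.
have trP (S : {set dstate M}) s' : reflect (exists s z, [/\ s \in S, unzip1 z = w,
    all (mem bs) (unzip2 z) & foldl (@dtrans _ M) s z = s'])
  (s' \in foldl tr S w).
  elim: w S => [|a w IHw] S /=.
    apply: (iffP idP) => [Ss'|[s [z [Ss zw _ <-]]]]; last by case: z zw.
    by exists s', [::].
  apply: (iffP (IHw _)) => [[s [z [Ss <- zb <-]]]|[s [z [Ss + + <-]]]].
    move: Ss; rewrite inE => /exists_inP[s1 Ss1 /hasP[b bsb /eqP Es]].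
    exists s1, ((a, b) :: z); rewrite /= Es; split=> //.
    by rewrite zb andbT.
  case: z => [|[a' b] z] //= [-> <-] /andP[bsb zb].
  exists (dtrans s (a, b)), z; split=> //.
  by rewrite inE; apply/exists_inP; exists s => //; apply/hasP; exists b.
split.
  case/exists_inP=> s' /trP[s [z [/set1P -> <- zb <-]]] fin.
  by exists z; split=> //; apply/hM.
case=> z [zw zb /hM Lz]; apply/exists_inP.
exists (foldl (@dtrans _ M) (dinit M) z) => //.
by apply/trP; exists (dinit M), z; rewrite set11.
Qed.

(** Recognizes one track of a convolution. The boolean in the state records that padding has begun,
    and [None] is a dead state entered when a letter follows padding. *)
Lemma regular_pad (A : Type) (L : seq A -> Prop) :
  regular L ->
  regular (fun x => exists u k, L u /\ x = map Some u ++ nseq k None).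
Proof.
move=> [M hM].
pose tr (s : option (dstate M * bool)) (a : option A) :=
  match s, a with
  | Some (s, false), Some a => Some (dtrans s a, false)
  | Some (s, _), None => Some (s, true)
  | _, _ => None
  end.
pose fin (s : option (dstate M * bool)) := if s is Some s then dfinal s.1 else false.
have trN x : foldl tr None x = None by elim: x.
have trT s k : foldl tr (Some (s, true)) (nseq k None) = Some (s, true).
  by elim: k.
have trTP s x : fin (foldl tr (Some (s, true)) x) ->
    x = nseq (size x) None.
  elim: x => [|[a|] x IHx] //=; first by rewrite trN.
  by move/IHx => {1}->.
apply: eq_regular (regular_fin (Some (dinit M, false)) tr fin) => x; split.
  have gen s : fin (foldl tr (Some (s, false)) x) -> exists u k,
      dfinal (foldl (@dtrans _ M) s u) /\ x = map Some u ++ nseq k None.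
    elim: x s => [|[a|] x IHx] s /=.
    - by move=> fs; exists [::], 0%N.
    - by move/IHx => [u [k [fu ->]]]; exists (a :: u), k.
    - move=> fx; have Ex := trTP _ _ fx; exists [::], (size x).+1.
      by move: fx; rewrite {1}Ex trT /= -Ex.
  by case/gen=> u [k [fu ->]]; exists u, k; split=> //; apply/hM.
case=> u [k [/hM Lu ->]].
rewrite foldl_cat.
have -> s : foldl tr (Some (s, false)) (map Some u) =
    Some (foldl (@dtrans _ M) s u, false) by elim: u s {Lu} => //=.
by case: k => [|k] //=; rewrite trT.
Qed.

Lemma regular_pumping (A : Type) (L : seq A -> Prop) :
  regular L ->
  exists N : nat, forall w, L w -> (N <= size w)%N ->
    exists u v z, [/\ w = u ++ v ++ z, (0 < size v)%N &
      forall i, L (u ++ flatten (nseq i v) ++ z)].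
Proof.
move=> [M hM]; exists #|dstate M| => w Lw szw.
pose st i := foldl (@dtrans _ M) (dinit M) (take i w).
(* Pigeonhole: there is one more prefix length than there are states. *)
have /injectivePn[i [j ij Eij]] :
    ~~ injectiveb (fun i : 'I_#|dstate M|.+1 => st i).
  by apply/injectiveP => /leq_card; rewrite card_ord ltnn.
wlog lij : i j ij Eij / (i < j)%N => [gen|].
  case: (ltngtP i j) => [||E]; first exact: gen.
    by apply: gen; rewrite 1?eq_sym.
  by rewrite (val_inj E) eqxx in ij.
have jw : (j <= size w)%N by apply: leq_trans szw; rewrite -ltnS.
pose v := drop i (take j w).
have Ej : take j w = take i w ++ v.
  by rewrite -(cat_take_drop i (take j w)) (take_takel _ (ltnW lij)).
have loop : foldl (@dtrans _ M) (st i) v = st i.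
  by rewrite {2}Eij /st Ej foldl_cat.
exists (take i w), v, (drop j w); split.
- by rewrite catA -Ej cat_take_drop.
- by rewrite size_drop size_takel // subn_gt0.
move=> k; apply/hM; rewrite /accepts !foldl_cat -/(st i).
have -> : foldl (@dtrans _ M) (st i) (flatten (nseq k v)) = st i.
  by elim: k => //= k IHk; rewrite foldl_cat loop.
move/hM: Lw; rewrite /accepts -{1}(cat_take_drop j w) foldl_cat.
by rewrite -/(st j) -Eij.
Qed.

(** * Convolution of words, track by track *)

Section Convolution.

Variables (A : Type).

Lemma nth_pad (u : seq A) k i :
  nth None (map Some u ++ nseq k None) i = onth u i.
Proof.
rewrite onthE nth_cat size_map nth_nseq if_same.
by case: ltnP => // ui; rewrite nth_default ?size_map.
Qed.

Lemma mkseq_onth (u : seq A) m : (size u <= m)%N ->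
  mkseq (onth u) m = map Some u ++ nseq (m - size u) None.
Proof.
move=> um; apply: (@eq_from_nth _ None).
  by rewrite size_mkseq size_cat size_map size_nseq subnKC.
by move=> i; rewrite size_mkseq => im; rewrite nth_mkseq // nth_pad.
Qed.

(** Splits being a convolution into conditions that automata can check separately. Excluding columns
    made only of padding forces the length to be the maximum of the three. *)
Lemma conv3P (u v w : seq A) x :
  x = conv3 u v w <->
  [/\ exists k, map (fun l => l.1.1) x = map Some u ++ nseq k None,
      exists k, map (fun l => l.1.2) x = map Some v ++ nseq k None,
      exists k, map (fun l => l.2) x = map Some w ++ nseq k None &
      all (fun l => [|| isSome l.1.1, isSome l.1.2 | isSome l.2]) x].
Proof.
split=> [->|[[k1 E1] [k2 E2] [k3 E3] /all_nthP xs]].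
  rewrite /conv3; set m := maxn _ _.
  have [um vm wm] : [/\ size u <= m, size v <= m & size w <= m]%N by split; rewrite /m; lia.
  split.
  - exists (m - size u)%N; rewrite -mkseq_onth // /mkseq -map_comp.
    exact: eq_map.
  - exists (m - size v)%N; rewrite -mkseq_onth // /mkseq -map_comp.
    exact: eq_map.
  - exists (m - size w)%N; rewrite -mkseq_onth // /mkseq -map_comp.
    exact: eq_map.
  apply/(all_nthP (None, None, None)) => i; rewrite size_mkseq => im.
  by rewrite nth_mkseq //= !onthTE; lia.
have {}xs := xs (None, None, None).
have nthx i : nth (None, None, None) x i = (onth u i, onth v i, onth w i).
  rewrite -(nth_pad u k1) -(nth_pad v k2) -(nth_pad w k3) -E1 -E2 -E3.
  case: (ltnP i (size x)) => xi; last by rewrite !nth_default ?size_map.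
  rewrite !(nth_map (None, None, None)) //.
  by case: (nth _ x i) => [[]].
have s1 := congr1 size E1; have s2 := congr1 size E2.
have s3 := congr1 size E3; move: s1 s2 s3.
rewrite !size_cat !size_map !size_nseq => s1 s2 s3.
have sx : size x = maxn (size u) (maxn (size v) (size w)).
  apply/eqP; rewrite eqn_leq andbC; apply/andP; split; first by lia.
  rewrite leqNgt; apply/negP => /xs; rewrite nthx /= !onthTE; lia.
apply: (@eq_from_nth _ (None, None, None)); first by rewrite size_mkseq.
by move=> i; rewrite sx => xi; rewrite nthx nth_mkseq.
Qed.

Lemma conv2_diag (v : seq A) : conv2 v v = map (fun a => (Some a, Some a)) v.
Proof.
apply: eq_from_onth => i; rewrite onth_map /conv2 /mkseq onth_map maxnn.
case: (ltnP i (size v)) => iv; last first.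
  by rewrite !onth_default ?size_iota.
have: onth v i by rewrite onthTE.
case E: (onth v i) => [a|] // _ /=.
by rewrite onthE (nth_map 0%N) ?size_iota // nth_iota //= E.
Qed.

Lemma conv2_diag_inj (u v w : seq A) : conv2 w w = conv2 u v -> u = w /\ v = w.
Proof.
have onth2 (a b : seq A) i : onth (conv2 a b) i =
    if (i < maxn (size a) (size b))%N then Some (onth a i, onth b i) else None.
  rewrite /conv2 /mkseq onth_map; case: ltnP => im.
    by rewrite onthE (nth_map 0%N) ?size_iota // nth_iota.
  by rewrite onth_default ?size_iota.
move=> E; suff H i : onth u i = onth w i /\ onth v i = onth w i.
  by split; apply: eq_from_onth => i; case: (H i).
have := congr1 (fun s => onth s i) E; rewrite !onth2 maxnn.
case: ltnP => iw; case: ltnP => iuv //; first by case=> -> ->.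
by move=> _; rewrite !onth_default //; lia.
Qed.

End Convolution.

(** * The l1 norm on integer polynomials *)

Definition norm1 (f : {poly int}) : int := \sum_(i < size f) `|f`_i|.

Lemma norm1E (f : {poly int}) M :
  (size f <= M)%N -> norm1 f = \sum_(i < M) `|f`_i|.
Proof.
move=> fM; rewrite /norm1 -!(big_mkord xpredT (fun i => `|f`_i|)).
rewrite (big_cat_nat _ fM) //= [X in _ = _ + X]big_nat_cond.
rewrite [X in _ = _ + X]big1 ?addr0 // => i.
by rewrite andbT => /andP[fi _]; rewrite nth_default ?normr0.
Qed.

Lemma norm1_ge0 f : 0 <= norm1 f.
Proof. by apply: sumr_ge0. Qed.

Lemma norm1D f g : norm1 (f + g) <= norm1 f + norm1 g.
Proof.
pose M := maxn (size f) (size g).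
rewrite !(@norm1E _ M) ?size_polyD ?leq_maxl ?leq_maxr // -big_split /=.
by apply: ler_sum => i _; rewrite coefD ler_normD.
Qed.

Lemma norm1Z c f : norm1 (c *: f) = `|c| * norm1 f.
Proof.
rewrite (@norm1E _ (size f)) ?size_scale_leq // mulr_sumr.
by apply: eq_bigr => i _; rewrite coefZ normrM.
Qed.

Lemma norm1_drop f j :
  norm1 (drop_poly j f) = `|f`_j| + norm1 (drop_poly j.+1 f).
Proof.
rewrite (@norm1E _ (size f).+1) ?size_drop_poly; last by lia.
rewrite (@norm1E _ (size f)) ?size_drop_poly; last by lia.
rewrite big_ord_recl coef_drop_poly add0n; congr (_ + _).
by apply: eq_bigr => i _; rewrite !coef_drop_poly /= addSnnS.
Qed.

Lemma coef_le_norm1 (f : {poly int}) i : `|f`_i| <= norm1 f.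
Proof.
case: (ltnP i (size f)) => fi; last by rewrite nth_default // normr0 norm1_ge0.
by rewrite /norm1 (bigD1 (Ordinal fi)) //= lerDl sumr_ge0.
Qed.

Lemma norm1E0 f : norm1 f = `|f`_0| + norm1 (drop_poly 1 f).
Proof. by rewrite -{1}(drop_poly0l f) norm1_drop. Qed.

(** * Divisibility by [t], digit by digit *)

Section Divisibility.

Variables (t : {poly int}).

Definition tdvd (f : {poly int}) : Prop := exists h, f = h * t.

Lemma tdvd0 : tdvd 0.
Proof. by exists 0; rewrite mul0r. Qed.

Lemma tdvdD f g : tdvd f -> tdvd g -> tdvd (f + g).
Proof. by move=> [h ->] [k ->]; exists (h + k); rewrite mulrDl. Qed.

Lemma tdvdN f : tdvd f -> tdvd (- f).
Proof. by move=> [h ->]; exists (- h); rewrite mulNr. Qed.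

Lemma tdvdB f g : tdvd f -> tdvd g -> tdvd (f - g).
Proof. by move=> tf /tdvdN; apply: tdvdD. Qed.

Lemma tdvdMl k f : tdvd f -> tdvd (k * f).
Proof. by move=> [h ->]; exists (k * h); rewrite mulrA. Qed.

Lemma tdvd_small (f : {poly int}) : (size f < size t)%N -> tdvd f -> f = 0.
Proof.
move=> ft [h Ef]; rewrite Ef in ft *; apply/eqP/contraT => ht0.
have [h0 t0] : h != 0 /\ t != 0 by apply/andP; rewrite -negb_or -mulf_eq0.
have st : size (h * t) = (size h + size t).-1 by rewrite size_mul.
have sh : (0 < size h)%N by rewrite size_poly_gt0.
by move: ft; rewrite st; lia.
Qed.

Lemma drop1K (f : {poly int}) : f = drop_poly 1 f * 'X + (f`_0)%:P.
Proof.
apply/polyP => -[|i]; rewrite coefD coefMX coefC /= ?add0r //.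
by rewrite coef_drop_poly addr0 addn1.
Qed.

Hypothesis t00 : t`_0 != 0.

(** Comparing constant terms, the cofactor has constant term 0, so [X] can be cancelled from it. *)
Lemma tdvdMX f : tdvd (f * 'X) -> tdvd f.
Proof.
move=> [h Ef]; have := congr1 (fun g : {poly int} => g`_0) Ef.
rewrite coefMX coef0M => /esym/eqP; rewrite mulf_eq0 (negPf t00) orbF => /eqP h0.
exists (drop_poly 1 h); apply: (mulIf (negbT (polyX_eq0 _))).
by rewrite Ef {1}(drop1K h) h0 addr0 mulrAC.
Qed.

Lemma tdvdMXn f k : tdvd (f * 'X^k) -> tdvd f.
Proof. by elim: k => [|k IHk]; rewrite ?expr0 ?mulr1 // exprSr mulrA => /tdvdMX. Qed.

(** The digit [a] enters only through the quotient: as a constant term it is discarded by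
    [drop_poly 1]. The quotient is exact only under the divisibility tested in [tdvd_carry]. *)
Definition carry (g : {poly int}) (a : int) : {poly int} :=
  drop_poly 1 (g - ((g`_0 + a) %/ t`_0)%Z *: t).

Lemma tdvd_carry g a w : tdvd (g + Poly (a :: w)) <->
  (t`_0 %| g`_0 + a)%Z /\ tdvd (carry g a + Poly w).
Proof.
set c := ((g`_0 + a) %/ t`_0)%Z.
have Eg : (t`_0 %| g`_0 + a)%Z ->
    g + Poly (a :: w) = (carry g a + Poly w) * 'X + c%:P * t.
  move=> dv; rewrite /= cons_poly_def; rewrite {1}(drop1K g) {1}(drop1K t).
  rewrite /carry -/c linearB linearZ /= -mul_polyC.
  have -> : (g`_0)%:P = c%:P * (t`_0)%:P - a%:P :> {poly int}.
    by rewrite -polyCM divzK // polyCD addrK.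
  by ring.
split=> [tg|[dv tg]].
  have dv : (t`_0 %| g`_0 + a)%Z.
    case: tg => h /(congr1 (fun f : {poly int} => f`_0)).
    by rewrite coefD coef_Poly coef0M /= => ->; apply: dvdz_mull.
  split=> //; apply: tdvdMX.
  rewrite -(addrK (c%:P * t) (_ * 'X)) -Eg //.
  by apply: tdvdB => //; exists c%:P.
by rewrite Eg //; apply: tdvdD; [rewrite mulrC; apply: tdvdMl | exists c%:P].
Qed.

Hypothesis t_dom : norm1 (drop_poly 1 t) < `|t`_0|.

(** With [T] the norm of the non-constant part of [t], the quotient [c] satisfies
    [|c| |t_0| <= D (T + 1) <= D |t_0|], hence [|c| <= D]. Coefficient [j] of the new carry is
    [g_(j+1) - c t_(j+1)], and the second term contributes exactly the next summand of the tail
    norm. *)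
Lemma carry_bound (D : int) (g : {poly int}) (a : int) : 0 <= D -> `|a| <= D ->
  (t`_0 %| g`_0 + a)%Z ->
  (forall j, `|g`_j| <= D * norm1 (drop_poly j.+1 t)) ->
  forall j, `|(carry g a)`_j| <= D * norm1 (drop_poly j.+1 t).
Proof.
move=> D0 aD dv gD j; rewrite coef_drop_poly coefB coefZ addn1.
set c := (_ %/ _)%Z.
have cD : `|c| <= D.
  have : `|c| * `|t`_0| <= D * norm1 (drop_poly 1 t) + D.
    rewrite -normrM divzK //; apply: le_trans (ler_normD _ _) _.
    exact: lerD (gD 0%N) aD.
  move: t_dom (norm1_ge0 (drop_poly 1 t)).
  move: (norm1 _) `|t`_0| `|c| (normr_ge0 c) => T Q C; nia.
rewrite norm1_drop mulrDr [leRHS]addrC; apply: le_trans (ler_normB _ _) _.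
by rewrite normrM lerD // ler_wpM2r.
Qed.

Lemma regular_tdvd (D : nat) :
  regular (fun w => tdvd (Poly w) /\ all (fun a : int => `|a| <= D%:Z) w).
Proof.
pose n := (size t).-1.
pose K := (`|(D%:Z * norm1 (drop_poly 1 t))%R|)%N.
pose tr (s : option {poly int}) (a : int) := if s is Some g then
    if (`|a| <= D%:Z) && (t`_0 %| g`_0 + a)%Z then Some (carry g a) else None
  else None.
pose inv (s : option {poly int}) := if s is Some g then
  forall j, `|g`_j| <= D%:Z * norm1 (drop_poly j.+1 t) else True.
(* Coefficients of a carry lie between [-K] and [K]; the shift by [K] makes them natural numbers. *)
pose enc : option {poly int} -> option {ffun 'I_n -> 'I_(K + K).+1} :=
  omap (fun g : {poly int} => [ffun i : 'I_n => inord `|(g`_i + K%:Z)%R|%N]).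
pose dec : option {ffun 'I_n -> 'I_(K + K).+1} -> option {poly int} :=
  omap (fun f : {ffun 'I_n -> 'I_(K + K).+1} => \poly_(i < n)
     (if insub i is Some j then (f j)%:Z - K%:Z else 0)).
have t0 : t != 0 by apply: contraNneq t00 => ->; rewrite coef0.
have inv_size (g : {poly int}) : inv (Some g) -> (size g <= n)%N.
  move=> gD; apply/leq_sizeP => j nj; apply/eqP; rewrite -normr_le0.
  apply: le_trans (gD j) _; rewrite drop_poly_eq0; last by lia.
  by rewrite /norm1 size_poly0 big_ord0 mulr0.
have inv_K (g : {poly int}) i : inv (Some g) -> `|g`_i| <= K.
  move=> gD; apply: le_trans (gD i) _; rewrite /K.
  suff : norm1 (drop_poly i.+1 t) <= norm1 (drop_poly 1 t).
    by move: (norm1 _) (norm1 _) => x y; nia.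
  elim: i => // i; apply: le_trans.
  by rewrite (norm1_drop t i.+1) lerDr.
apply: (eq_regular (L := fun w => foldl tr (Some 0) w == Some 0)); last first.
  apply: (@regular_enc _ _ _ (Some 0) tr (fun s => s == Some 0) inv enc dec).
  - by move=> j; rewrite coef0 normr0 mulr_ge0 // norm1_ge0.
  - move=> [g|] a //= gD; case: ifP => // /andP[aD dv].
    exact: carry_bound.
  move=> [g|] // gD; rewrite /dec /enc /=; congr Some.
  apply/polyP => i; rewrite coef_poly; case: ltnP => ni; last first.
    by rewrite nth_default // (leq_trans (inv_size _ gD)).
  rewrite insubT ffunE inordK; have := inv_K g i gD; rewrite /=; lia.
move=> w; suff H (g : {poly int}) : inv (Some g) ->
    foldl tr (Some g) w == Some 0 <->
    tdvd (g + Poly w) /\ all (fun a : int => `|a| <= D%:Z) w.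
  rewrite H; first by rewrite add0r.
  by move=> j; rewrite coef0 normr0 mulr_ge0 // norm1_ge0.
elim: w g => [|a w IHw] g gD.
  rewrite /= addr0; split=> [/eqP[->]|[tg _]]; first by split=> //; apply: tdvd0.
  (* The final carry has smaller degree than [t], so only zero is divisible by [t]. *)
  rewrite (tdvd_small _ tg) //; have := inv_size g gD; rewrite /n.
  by have := size_poly_gt0 t; rewrite t0; lia.
rewrite [all _ _]/= tdvd_carry.
have trN x : foldl tr None x = None by elim: x.
rewrite [foldl _ _ _]/=; case: (boolP (`|a| <= _)) => aD /=; last first.
  by rewrite trN; split=> // -[].
case: (boolP (t`_0 %| _)%Z) => dv /=; last by rewrite trN; split=> // -[[]].
by rewrite IHw; [by split=> [[]|[[_]]] | apply: carry_bound].
Qed.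

(** Rounding towards zero leaves [c * d] and [a] without opposite signs, so no cancellation occurs
    in their sum. *)
Lemma truncated_division (x d : int) : d != 0 ->
  exists c a, [/\ x = c * d + a, `|a| < `|d| & `|c| * `|d| + `|a| = `|x|].
Proof.
move=> d0.
exists (sgz x * sgz d * (`|x| %/ `|d|)%N%:Z), (sgz x * (`|x| %% `|d|)%N%:Z).
have := divn_eq `|x| `|d|; have : (`|x| %% `|d| < `|d|)%N by rewrite ltn_mod; lia.
move: (_ %% _)%N (_ %/ _)%N => r m rd Ex.
case: (sgzP x) => hx; case: (sgzP d) => hd; split; nia.
Qed.

(** Induction on a bound for the norm, then on the size. Passing from [f] to [f1] lowers the norm by
    at least [|c| + |a|], which is positive unless [f_0 = 0]; in that case [c = 0] and [f1] is [f]
    divided by [X]. *)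
Lemma tdvd_digits (f : {poly int}) :
  exists w, all (fun a => `|a| < `|t`_0|) w /\ tdvd (Poly w - f).
Proof.
have [N] : exists N : nat, norm1 f < N%:Z.
  by exists (`|norm1 f|.+1)%N; have := norm1_ge0 f; lia.
elim: N f => [|N IHN] f fN; first by have := norm1_ge0 f; lia.
have [M] := ubnPleq (size f); elim: M f fN => [|M IHM] f fN fM.
  move: fM; rewrite leqn0 size_poly_eq0 => /eqP ->.
  by exists [::]; split=> //; rewrite subrr; apply: tdvd0.
have [c [a [Ef ad Ec]]] := truncated_division f`_0 t00.
pose f1 := drop_poly 1 (f - c *: t).
suff [w [wd tw]] :
    exists w, all (fun a => `|a| < `|t`_0|) w /\ tdvd (Poly w - f1).
  exists (a :: w); split; first by rewrite /= ad.
  rewrite /= cons_poly_def.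
  have -> : Poly w * 'X + a%:P - f = 'X * (Poly w - f1) - c%:P * t.
    rewrite {1}(drop1K f) {1}(drop1K t) Ef /f1 linearB linearZ /= -mul_polyC.
    by rewrite polyCD polyCM; ring.
  by apply: tdvdB; [apply: tdvdMl | exists c%:P].
case: (eqVneq f`_0 0) => f0.
  have c0 : c = 0 by rewrite f0 in Ec; apply/eqP; rewrite -normr_le0; nia.
  rewrite /f1 c0 scale0r subr0; apply: IHM; last by rewrite size_drop_poly; lia.
  by apply: le_lt_trans fN; rewrite [norm1 f]norm1E0 lerDr.
apply: IHN.
have : norm1 f1 <= norm1 (drop_poly 1 f) + `|c| * norm1 (drop_poly 1 t).
  rewrite /f1 linearB linearZ /= -scaleNr -(normrN c) -norm1Z.
  exact: norm1D.
have cT : `|c| * norm1 (drop_poly 1 t) <= `|c| * (`|t`_0| - 1).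
  by rewrite ler_wpM2l // lerBrDr -ltzD1 ltrD2r.
have ca : 0 < `|c| + `|a|.
  have [c0|c0] := eqVneq c 0; last by rewrite ltr_pwDl // normr_gt0.
  by rewrite ltr_wpDl // normr_gt0; apply: contraNneq f0 => a0; rewrite Ef c0 a0 mul0r.
by move: fN cT; rewrite (norm1E0 f) mulrBr mulr1 -Ec; lia.
Qed.

End Divisibility.

(** * The length-lexicographic order and its embedding into the natural numbers *)

Section LengthLexicographicOrder.

Lemma lexlt_total (u w : seq int) :
  size u = size w -> [\/ u = w, lexlt u w | lexlt w u].
Proof.
elim: u w => [|a u IHu] [|b w] //=; first by constructor 1.
case=> szuw.
have [ab|ab|->] := ltgtP a b; [by constructor 2 | by constructor 3 |].
case: (IHu w szuw) => [->|h|h]; rewrite ?h /=;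
  by [constructor 1 | constructor 2 | constructor 3].
Qed.

Lemma llt_total (u w : seq int) : [\/ u = w, llt u w | llt w u].
Proof.
rewrite /llt; have [h|h|h] := ltngtP (size u) (size w).
- by constructor 2.
- by constructor 3.
by rewrite /=; apply: lexlt_total.
Qed.

Lemma regular_lexlt (A : Type) (f g : A -> int) :
  regular (fun z => lexlt (map f z) (map g z)).
Proof.
(* The state is [None] while the words agree; the verdict at the first difference is final. *)
pose tr (s : option bool) a := if s is Some b then Some b else
  if f a == g a then None else Some (f a < g a).
apply: eq_regular (regular_fin None tr (fun s => s == Some true)) => z.
suff -> : (foldl tr None z == Some true) = lexlt (map f z) (map g z) by [].
have trS b x : foldl tr (Some b) x = Some b by elim: x.
elim: z => //= a z IHz; case: (eqVneq (f a) (g a)) => [->|fg].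
  by rewrite ltxx.
by rewrite trS orbF; case: (f a < g a).
Qed.

Variable q : int.

(* The digit string [w] read as a number in base [2|q|], most significant digit
   first, with the digits shifted to [1, 2|q| - 1]. *)
Definition word_code (c : nat) (w : seq int) : nat :=
  foldl (fun c a => c * (2 * `|q|) + `|(a + `|q|)%R|)%N c w.

Lemma word_code_ge c w : in_Sigma q w -> (c <= word_code c w)%N.
Proof.
elim: w c => //= a w IHw c /andP[aq wq].
by apply: leq_trans (IHw _ wq); nia.
Qed.

Lemma word_code_lt c w : in_Sigma q w ->
  (word_code c w < c.+1 * (2 * `|q|) ^ size w)%N.
Proof.
elim: w c => [|a w IHw] c /=; first by rewrite expn0; lia.
move=> /andP[aq wq]; apply: leq_trans (IHw _ wq) _.
by rewrite expnS [leqRHS]mulnA leq_mul2r; apply/orP; right; nia.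
Qed.

Lemma word_code_mono c d u w : in_Sigma q u -> in_Sigma q w ->
  size u = size w -> (c < d)%N -> (word_code c u < word_code d w)%N.
Proof.
elim: u w c d => [|a u IHu] [|b w] //= c d /andP[aq uq] /andP[bq wq] [szuw] cd.
by apply: IHu => //; nia.
Qed.

(** For a shorter [u], the surplus prefix of [w] has positive code because shifted digits are
    nonzero, and [word_code_mono] compares the rest. *)
Lemma word_code_llt u w : in_Sigma q u -> in_Sigma q w ->
  llt u w -> (word_code 0 u < word_code 0 w)%N.
Proof.
move=> uq wq /orP[szuw|/andP[/eqP szuw]].
  rewrite -(cat_take_drop (size w - size u) w) /word_code foldl_cat.
  move: wq; rewrite -{1}(cat_take_drop (size w - size u) w) /in_Sigma all_cat.
  move=> /andP[tq dq]; apply: word_code_mono => //.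
    by rewrite size_drop; lia.
  have : (0 < size (take (size w - size u) w))%N by rewrite size_takel; lia.
  case: (take _ w) tq => //= a v /andP[aq vq] _.
  by apply: leq_trans (word_code_ge _ vq); lia.
elim: u w 0%N uq wq szuw => [|a u IHu] [|b w] //= c /andP[aq uq] /andP[bq wq].
move=> [szuw] /orP[ab|/andP[/eqP <- uw]]; last exact: IHu.
by apply: word_code_mono => //; lia.
Qed.

Lemma word_code_inj u w : in_Sigma q u -> in_Sigma q w ->
  word_code 0 u = word_code 0 w -> u = w.
Proof.
move=> uq wq E; case: (llt_total u w) => // /word_code_llt.
  by move/(_ uq wq); rewrite E ltnn.
by move/(_ wq uq); rewrite E ltnn.
Qed.

End LengthLexicographicOrder.

(** * Least representatives: regularity, existence, addition, and multiples of [x^k] *)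

Section NormalForms.

Variables (q : int) (t : {poly int}).
Hypothesis tq : `|t`_0| = `|q|.
Hypothesis t00 : t`_0 != 0.
Hypothesis t_dom : norm1 (drop_poly 1 t) < `|t`_0|.

(** This is [Dom] for a general [t], convertible to it at [t = tpoly n p q]. *)
Definition normal (w : seq int) : Prop :=
  in_Sigma q w /\
  forall u, in_Sigma q u -> llt u w -> ~ simt t (spoly u) (spoly w).

Lemma normal_inj u v : normal u -> normal v ->
  simt t (spoly u) (spoly v) -> u = v.
Proof.
move=> [uq nu] [vq nv] uv; case: (llt_total u v) => // lt.
  by case: (nv u uq lt).
by case: (nu v vq lt); have := tdvdN uv; rewrite opprB.
Qed.

(* A shorter equivalent word, padded with zeros (the high-order digits come last),
   is as long as [w] and ends in 0. *)
Definition reducible (w : seq int) : Prop :=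
  exists y, [/\ size y = size w, in_Sigma q y, simt t (spoly y) (spoly w) &
                lexlt y w \/ last 1 y = 0].

Lemma q_gt0 : (0 < `|q|)%N.
Proof. by move: t00; rewrite -normr_eq0 tq; lia. Qed.

Lemma Poly_pad0 (u : seq int) k : Poly (u ++ nseq k 0) = Poly u.
Proof.
apply/polyP => i; rewrite !coef_Poly nth_cat nth_nseq if_same.
by case: ltnP => // ui; rewrite nth_default.
Qed.

Lemma reducibleP w : in_Sigma q w ->
  reducible w <->
  exists u, [/\ in_Sigma q u, llt u w & simt t (spoly u) (spoly w)].
Proof.
move=> wq; split.
  case=> y [szy yq yw [ltyw|y0]].
    by exists y; split=> //; rewrite /llt szy eqxx ltyw orbT.
  (* The default 1 of [last] rules out the empty word, so there is a final 0 to remove. *)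
  case: (lastP y) y0 szy yq yw => // u a; rewrite last_rcons => ->.
  rewrite -cats1 /in_Sigma all_cat size_cat addn1 => szu /andP[uq _] uw.
  exists u; rewrite /llt -szu ltnSn; split=> //.
  by rewrite /spoly -(Poly_pad0 u 1).
case=> u [uq /orP[szuw|/andP[/eqP szuw ltuw]] uw]; last first.
  by exists u; split=> //; left.
exists (u ++ nseq (size w - size u) 0); split.
- by rewrite size_cat size_nseq; lia.
- rewrite /in_Sigma all_cat [X in X && _]uq all_nseq normr0 orbC /=.
  by have := q_gt0; lia.
- by rewrite /spoly Poly_pad0.
right; case: (size w - size u)%N (subn_gt0 (size u) (size w)) => [|k _].
  by rewrite szuw.
by rewrite last_cat /=  ; elim: k.
Qed.

Lemma regular_in_Sigma : regular (fun w => in_Sigma q w).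
Proof. exact: regular_all. Qed.

(** The word [y] is guessed on a second track of equal length; equivalence is divisibility of the
    word of digit differences, which [in_Sigma] bounds by [2 |q|]. *)
Lemma regular_reducible : regular (fun w => reducible w /\ in_Sigma q w).
Proof.
pose sub (z : int * int) := z.2 - z.1.
pose L (z : seq (int * int)) :=
  (tdvd t (Poly (map sub z)) /\
   all (fun a : int => `|a| <= (2 * `|q|)%N%:Z) (map sub z)) /\
  (lexlt (map snd z) (map fst z) \/ last 1 (map snd z) == 0) /\
  in_Sigma q (map snd z).
(* The integers from [-|q|] to [|q| - 1], a finite alphabet containing all digits. *)
pose bs : seq int := [seq i%:Z - `|q| | i <- iota 0 (2 * `|q|)].
have regL : regular L.
  apply: regular_and; first exact: regular_premap (regular_tdvd t00 t_dom _).
  apply: regular_and; last exact: regular_premap regular_in_Sigma.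
  apply: regular_or; first exact: regular_lexlt.
  exact: (regular_premap snd (regular_last (fun a : int => a == 0) 1)).
apply: eq_regular (regular_and (regular_proj bs regL) regular_in_Sigma) => w.
have PolyB (z : seq (int * int)) : 
    Poly (map sub z) = Poly (map snd z) - Poly (map fst z).
  elim: z => [|x z IHz] /=; first by rewrite subr0.
  by rewrite !cons_poly_def IHz polyCB; ring.
split=> [[[z [<- _ [[tz _] [ltz zq]]]] wq]|[[y [szy yq yw ltyw]] wq]].
  split=> //; exists (unzip2 z); split=> //; first by rewrite !size_map.
    by rewrite /simt /spoly -PolyB.
  by case: ltz => [|/eqP]; [left | right].
have E1 : unzip1 (zip w y) = w by rewrite unzip1_zip // szy.
have E2 : unzip2 (zip w y) = y by rewrite unzip2_zip // szy.
split=> //; exists (zip w y); split=> //.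
  rewrite E2; apply/allP => a /(allP yq) aq; apply/mapP.
  by exists `|(a + `|q|)%R|%N; rewrite ?mem_iota; lia.
rewrite /L PolyB -/(unzip1 _) -/(unzip2 _) E1 E2; split; last first.
  by split=> //; case: ltyw => [|/eqP]; [left | right].
split=> //; rewrite all_map; apply/allP => -[a b] /= abz.
have /(allP wq) aq : a \in w by rewrite -E1; apply: (map_f fst abz).
have /(allP yq) bq : b \in y by rewrite -E2; apply: (map_f snd abz).
by rewrite /sub /=; lia.
Qed.

Lemma normalE w : normal w <-> in_Sigma q w /\ ~ (reducible w /\ in_Sigma q w).
Proof.
split=> [[wq nw]|[wq nr]].
  by split=> // -[/(reducibleP wq)[u [uq ltu uw]] _]; apply: nw uw.
split=> // u uq ltu uw; apply: nr; split=> //.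
by apply/(reducibleP wq); exists u.
Qed.

Lemma regular_normal : regular normal.
Proof.
apply: eq_regular (regular_and regular_in_Sigma (regular_not regular_reducible)).
by move=> w; rewrite normalE.
Qed.

(** Descent on [word_code] from any digit representative; [regular_dec] decides whether a smaller
    equivalent word exists. *)
Lemma normal_form f : exists w, normal w /\ simt t (spoly w) f.
Proof.
have [w0 []] := tdvd_digits t00 t_dom f; rewrite tq => wq wf.
have [N] := ubnP (word_code q 0 w0); elim: N w0 wq wf => // N IHN w wq wf wN.
case: (regular_dec regular_reducible w) => [[/(reducibleP wq)]|nr].
  case=> u [uq ltu uw] _; apply: (IHN u) => //.
    by have := tdvdD uw wf; rewrite /spoly subrKA.
  exact: leq_trans (word_code_llt uq wq ltu) wN.
by exists w; split=> //; apply/normalE.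
Qed.

(** With padding read as the digit 0, the columns give digits [a + b - c] bounded by [3 |q|], whose
    word must be divisible by [t]. *)
Lemma normal_add_FA_rec : FA_rec3 (fun u v w =>
  [/\ normal u, normal v, normal w & simt t (spoly u + spoly v) (spoly w)]).
Proof.
pose pad (x : seq (option int)) :=
  exists u k, normal u /\ x = map Some u ++ nseq k None.
pose sub (l : option int * option int * option int) :=
  odflt 0 l.1.1 + odflt 0 l.1.2 - odflt 0 l.2.
have regpad : regular pad := regular_pad regular_normal.
have Psub x : Poly (map sub x) = Poly (map (fun l => odflt 0 l.1.1) x) +
    Poly (map (fun l => odflt 0 l.1.2) x) - Poly (map (fun l => odflt 0 l.2) x).
  elim: x => [|l x IHx] /=; first by rewrite subr0 addr0.
  by rewrite !cons_poly_def IHx /sub polyCB polyCD; ring.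
have Ppad (A : Type) (pr : A -> option int) (x : seq A) u k :
    map pr x = map Some u ++ nseq k None ->
    Poly (map (fun l => odflt 0 (pr l)) x) = Poly u.
  move=> E; rewrite (map_comp (odflt 0) pr) E map_cat -map_comp map_nseq /=.
  by rewrite Poly_pad0 (eq_map (g := id)) ?map_id.
have qpad (A : eqType) (pr : A -> option int) (x : seq A) u k l :
    map pr x = map Some u ++ nseq k None -> in_Sigma q u -> l \in x ->
    `|odflt 0 (pr l)| < `|q|.
  move=> E uq /(map_f pr); rewrite E mem_cat mem_nseq => /orP[|/andP[_]].
    by case/mapP=> a /(allP uq) aq ->.
  by move=> /eqP->; rewrite normr0; have := q_gt0; lia.
apply: (eq_regular (L := fun x =>
  (pad (map (fun l => l.1.1) x) /\ pad (map (fun l => l.1.2) x) /\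
   pad (map (fun l => l.2) x)) /\
  all (fun l => [|| isSome l.1.1, isSome l.1.2 | isSome l.2]) x /\
  (tdvd t (Poly (map sub x)) /\
   all (fun a : int => `|a| <= (3 * `|q|)%N%:Z) (map sub x)))); last first.
  apply: regular_and.
    apply: regular_and; last apply: regular_and; exact: regular_premap regpad.
  apply: regular_and; first exact: regular_all.
  exact: regular_premap (regular_tdvd t00 t_dom _).
move=> x; split.
  case=> [[[u [k1 [nu E1]]] [[v [k2 [nv E2]]] [w [k3 [nw E3]]]]] [xs [tx _]]].
  exists u, v, w; split; last by apply/conv3P; split=> //; eexists; eassumption.
  split=> //; rewrite /simt /spoly.
  by rewrite -(Ppad _ _ _ _ _ E1) -(Ppad _ _ _ _ _ E2) -(Ppad _ _ _ _ _ E3) -Psub.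
case=> u [v [w [[nu nv nw uvw] /conv3P[[k1 E1] [k2 E2] [k3 E3] xs]]]].
split; first by split; [exists u, k1 | split; [exists v, k2 | exists w, k3]].
split=> //; split.
  by rewrite Psub (Ppad _ _ _ _ _ E1) (Ppad _ _ _ _ _ E2) (Ppad _ _ _ _ _ E3).
rewrite all_map; apply/allP => l xl /=.
have := qpad _ _ _ _ _ _ E1 (proj1 nu) xl; have := qpad _ _ _ _ _ _ E2 (proj1 nv) xl.
have := qpad _ _ _ _ _ _ E3 (proj1 nw) xl; rewrite /sub.
by move: (odflt 0 _) (odflt 0 _) (odflt 0 _) => c b a; lia.
Qed.

(* Reading off the coefficient of [x^(i+1)] in [h t] shows that, modulo higher
   powers of [t_0], each coefficient [h_i] is determined by the lower ones; so
   all of them are divisible by every power of [t_0]. *)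
Lemma tdvd_binomial (b : nat) (m0 m1 : int) :
  (2 < size t)%N -> coprimez t`_1 t`_0 -> (0 < b)%N ->
  tdvd t (m0 *: 'X^b - m1%:P) -> m0 = 0.
Proof.
move=> szt cop b0 [h Eh].
have q1 : (1 < `|(t`_0)%R|)%N.
  suff : 1 <= norm1 (drop_poly 1 t) by move: t_dom; lia.
  apply: le_trans (coef_le_norm1 _ (size t - 2)%N).
  rewrite coef_drop_poly; have -> : (size t - 2 + 1)%N = (size t).-1 by lia.
  rewrite -lead_coefE; have : lead_coef t != 0; last by lia.
  by rewrite lead_coef_eq0 -size_poly_gt0; lia.
suff h0 : h = 0.
  have := congr1 (fun f : {poly int} => f`_b) Eh.
  rewrite h0 mul0r coef0 coefB coefZ coefXn coefC eqxx mulr1.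
  by rewrite eqn0Ngt b0 /= subr0.
have szh i : (i < size h)%N -> (i.+1 < b)%N.
  move=> ih; have h0 : h != 0 by rewrite -size_poly_gt0; lia.
  have t0 : t != 0 by rewrite -size_poly_gt0; lia.
  have : size (h * t) = (size h + size t).-1 by rewrite size_mul.
  suff : (size (h * t)%R <= b.+1)%N by lia.
  rewrite -Eh; apply/leq_sizeP => j bj; rewrite coefB coefZ coefXn coefC.
  by rewrite (gtn_eqF bj) (gtn_eqF (leq_ltn_trans _ bj)) // mulr0 subr0.
have dv s : forall i, ((t`_0 ^+ s)%R %| h`_i)%Z.
  elim: s => [|s IHs]; first by move=> i; rewrite expr0 dvd1z.
  elim/ltn_ind => i IHi.
  case: (ltnP i (size h)) => ih; last by rewrite nth_default ?dvdz0.
  have := congr1 (fun f : {poly int} => f`_i.+1) Eh.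
  rewrite coefB coefZ coefXn coefC (ltn_eqF (szh i ih)) mulr0 subr0 coefM.
  rewrite !big_ord_recr /= subnn subSnn => /esym/eqP.
  rewrite addrAC addr_eq0 => /eqP E.
  rewrite -(@Gauss_dvdzl _ _ t`_1); last by rewrite coprimezXl // coprimez_sym.
  rewrite -rpredN -E; apply: rpredD; last by rewrite exprSr dvdz_mul.
  by apply: rpred_sum => j _; rewrite dvdz_mulr // IHi /=.
apply/polyP => i; rewrite coef0; apply/eqP/contraT => hi0.
(* The exponent [|h_i|] suffices, as [|h_i| < |t_0|^|h_i|]. *)
have := dv `|(h`_i)%R|%N i; rewrite dvdzE abszX => /dvdn_leq.
by rewrite absz_gt0 => /(_ hi0); rewrite leqNgt ltn_expl.
Qed.

Lemma normal_multiples_not_regular (k : nat) :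
  (2 < size t)%N -> coprimez t`_1 t`_0 ->
  ~ regular (fun w => normal w /\ exists m : int, simt t (spoly w) (m *: 'X^k)).
Proof.
move=> szt cop /regular_pumping[N pump].
have [w [nw [m wm] wN]] : exists w, [/\ normal w,
    exists m : int, simt t (spoly w) (m *: 'X^k) & (N <= size w)%N].
  (* Words shorter than [N] have code below [K], so they cannot represent all of the [K + 1]
     distinct classes of [i x^k] with [i <= K]. *)
  pose K := ((2 * `|q|) ^ N)%N.
  have /fin_all_exists[w wP] (i : 'I_K.+1) :=
    normal_form (i%:Z *: 'X^k : {poly int}).
  case: (boolP [exists i, (N <= size (w i))%N]) => [/existsP[i wi]|].
    by exists (w i); case: (wP i) => nw wi'; split=> //; exists i%:Z.
  rewrite negb_exists => /forallP wN.
  have wK i : (word_code q 0 (w i) < K)%N.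
    have [[wq _] _] := wP i; apply: leq_trans (word_code_lt 0 wq) _.
    rewrite mul1n leq_pexp2l ?muln_gt0 ?q_gt0 //.
    by rewrite ltnW // ltnNge.
  have /leq_card : injective (fun i => Ordinal (wK i)); last first.
    by rewrite !card_ord ltnn.
  move=> i j [] /word_code_inj E.
  have [[[iq _] iw] [[jq _] jw]] := (wP i, wP j).
  have {}E := E iq jq; rewrite E in iw.
  have := tdvdB jw iw; rewrite opprB addrC addrA subrK -scalerBl => ij.
  have /tdvdMXn : tdvd t ((i%:Z - j%:Z)%:P * 'X^k) by rewrite mul_polyC.
  move=> /(_ t00)/tdvd_small; rewrite size_polyC => /(_ _)/eqP.
  rewrite polyC_eq0 subr_eq0 => H; apply/val_inj.
  have /eqP[] // : i%:Z == j%:Z by apply: H; case: (_ == _); lia.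
have [u [v [z [_ v0 uvz]]]] := pump w (conj nw (ex_intro _ m wm)) wN.
pose P i : {poly int} := spoly (u ++ flatten (nseq i v) ++ z).
have Poly_cat (x y : seq int) : Poly (x ++ y) = Poly x + Poly y * 'X^(size x).
  elim: x => [|a x IHx] /=; first by rewrite expr0 mulr1 add0r.
  by rewrite !cons_poly_def IHx exprS; ring.
(* Inserting one more [v] multiplies the successive difference by [x^|v|]. *)
have EP : P 2 - P 1%N = (P 1%N - P 0%N) * 'X^(size v).
  by rewrite /P /spoly /= !cats0 !Poly_cat size_cat exprD; ring.
have [n0 [m0 P0]] := uvz 0%N; have [n1 [m1 P1]] := uvz 1%N.
have [_ [m2 P2]] := uvz 2; rewrite -/(P 0%N) -/(P 1%N) -/(P 2) in P0 P1 P2.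
(* Modulo [t], with [x^k] cancelled, this difference relation reads [(m1 - m0) x^|v| = m2 - m1]. *)
have m10 : m1 - m0 = 0.
  apply: (tdvd_binomial (b := size v) (m1 := m2 - m1)) => //.
  apply: (tdvdMXn t00 (k := k)).
  have := tdvdB (tdvdB P2 P1) (tdvdMl 'X^(size v) (tdvdB P1 P0)).
  have -> : P 2 = P 1%N + (P 1%N - P 0%N) * 'X^(size v) by rewrite -EP; ring.
  set lhs := (X in tdvd _ X -> _); set rhs := (X in _ -> tdvd _ X).
  suff -> : lhs = rhs by [].
  by rewrite /lhs /rhs -!mul_polyC !polyCB; ring.
have := tdvdB P1 P0; rewrite (subr0_eq m10).
rewrite opprB addrA subrK => P10.
(* The words with zero and one copy of [v] are equivalent and normal, yet differ in length. *)
have /(congr1 size) := normal_inj n1 n0 P10.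
by rewrite /= !size_cat; lia.
Qed.

End NormalForms.

(** * Coefficients of the polynomial [tpoly] *)

Section DefiningPolynomial.

Variables (n : nat) (p : nat -> int) (q : int).
Hypothesis n_gt0 : (0 < n)%N.

Lemma tpolyE :
  tpoly n p q = 'X^n + \poly_(i < n) (if i is 0 then - q else p i).
Proof.
rewrite /tpoly poly_def -addrA; congr (_ + _).
pose F i : {poly int} := (if i is 0 then - q else p i) *: 'X^i.
rewrite -(big_mkord xpredT F) big_ltn // /F expr0 alg_polyC polyCN.
rewrite addrC; congr (_ + _); rewrite !big_nat; apply: eq_bigr => -[|i] // _.
by rewrite mul_polyC.
Qed.

Lemma coef_tpoly i : (tpoly n p q)`_i =
  if i is 0 then - q else if (i < n)%N then p i else (i == n)%:R.
Proof.
rewrite tpolyE coefD coefXn coef_poly.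
case: i => [|i]; first by rewrite n_gt0 ltn_eqF // add0r.
by case: ltngtP => //; rewrite ?add0r ?addr0.
Qed.

Lemma size_tpoly : size (tpoly n p q) = n.+1.
Proof.
apply/eqP; rewrite eqn_leq; apply/andP; split.
  apply/leq_sizeP => j nj; rewrite coef_tpoly.
  by case: j nj => // j nj; rewrite ltnNge ltnW //= gtn_eqF.
rewrite ltnNge; apply/negP => /leq_sizeP/(_ n (leqnn n))/eqP.
by rewrite coef_tpoly ltnn eqxx; case: (n) n_gt0.
Qed.

(** Turns the assumed inequality on [p] and [q] into dominance of the constant term; the summand 1
    is the leading coefficient. *)
Lemma norm1_drop_tpoly :
  norm1 (drop_poly 1 (tpoly n p q)) = 1 + \sum_(1 <= i < n) `|p i|.
Proof.
rewrite (@norm1E _ n.-1.+1); last by rewrite size_drop_poly size_tpoly; lia.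
rewrite big_ord_recr /= coef_drop_poly addn1 coef_tpoly prednK // ltnn eqxx.
rewrite addrC normr1; congr (_ + _).
rewrite big_add1 big_mkord; apply: eq_bigr => i _.
by rewrite coef_drop_poly addn1 coef_tpoly; case: ltnP => //; have := ltn_ord i; lia.
Qed.

End DefiningPolynomial.

Theorem theorem2 (n : nat) (p : nat -> int) (q : int)
  (hn : (2 < n)%N)
  (hpq : 1 + \sum_(1 <= i < n) `|p i| < `|q|) :
  let t := tpoly n p q in
  (* Dom is regular *)
  regular (Dom n p q) /\
  (* psi : Dom -> Z^n = Z[x]/<t> is a bijection *)
  (forall u v, Dom n p q u -> Dom n p q v ->
      simt t (spoly u) (spoly v) -> u = v) /\
  (forall f : {poly int}, exists w, Dom n p q w /\ simt t (spoly w) f) /\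
  (* the addition relation transported via psi is FA-recognizable *)
  FA_rec3 (fun u v w => [/\ Dom n p q u, Dom n p q v, Dom n p q w &
                            simt t (spoly u + spoly v) (spoly w)]) /\
  (coprimez (p 1%N) q ->
   forall k : 'I_n,
     (* the preimage of the cyclic component <[x^k]> is not regular *)
     ~ regular (fun w => Dom n p q w /\
                  exists m : int, simt t (spoly w) (m *: 'X^k)) /\
     (* the projection onto <[x^k]> is not FA-recognizable *)
     ~ FA_rec2 (fun u v => [/\ Dom n p q u, Dom n p q v &
          exists c : 'I_n -> int,
            simt t (spoly u) (\sum_(i < n) c i *: 'X^i) /\
            simt t (spoly v) (c k *: 'X^k)])).
Proof.
move=> t.
have n0 : (0 < n)%N by lia.
have t0E : t`_0 = - q by rewrite coef_tpoly.
have tq : `|t`_0| = `|q| by rewrite t0E normrN.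
have t_dom : norm1 (drop_poly 1 t) < `|t`_0| by rewrite tq norm1_drop_tpoly.
have t00 : t`_0 != 0 by rewrite -normr_gt0 (le_lt_trans (norm1_ge0 _) t_dom).
do 4?split; first exact: (regular_normal tq t00 t_dom).
- exact: normal_inj.
- exact: (normal_form tq t00 t_dom).
- exact: (normal_add_FA_rec tq t00 t_dom).
move=> cop k.
have szt : (2 < size t)%N by rewrite size_tpoly //; lia.
have cop_t : coprimez t`_1 t`_0.
  by rewrite t0E coef_tpoly // ltnW // coprimezN.
have nreg := normal_multiples_not_regular (k := k) tq t00 t_dom szt cop_t.
split; first exact: nreg.
(* Reading [a] as the column [(a, a)] turns [w] into [conv2 w w], so the pulled-back language
   consists of the fixed points of the projection. *)
move=> /(regular_premap (fun a : int => (Some a, Some a))) reg.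
apply: nreg; apply: eq_regular reg => w; rewrite -conv2_diag; split.
  case=> u [v [[Du Dv [c [_ vc]]] /conv2_diag_inj[_ Ev]]].
  by rewrite -Ev; split=> //; exists (c k).
case=> Dw [m wm]; exists w, w; split=> //; split=> //.
exists (fun i => if i == k then m else 0); rewrite eqxx; split=> //.
rewrite (bigD1 k) //= eqxx big1 ?addr0 // => i /negPf ->.
by rewrite scale0r.
Qed.
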